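(* Let $\boldsymbol{z} = \{x_g, b_g, p_{g,t}, d^{\mathrm{ns}}_t \mid g\in\boldsymbol{G}, t\in\boldsymbol{T}\}$ be a feasible solution to the full-scale model (F). Let $\boldsymbol{\hat z} = \{\hat x_g,\hat b_g,\hat p_{g,k},\hat d^{\mathrm{ns}}_k \mid g\in\boldsymbol{G}, k\in\boldsymbol{K}\}$ be derived from $\boldsymbol{z}$ by $$\hat x_g := x_g,\quad \hat b_g := b_g,\quad \hat p_{g,k} := \frac{1}{T_k}\sum_{t\in\boldsymbol{T}_k} p_{g,t},\quad \hat d^{\mathrm{ns}}_k := \frac{1}{T_k}\sum_{t\in\boldsymbol{T}_k} d^{\mathrm{ns}}_t \qquad \text{for all } g\in\boldsymbol{G},\ k\in\boldsymbol{K}.$$ Then $\boldsymbol{\hat z}$ is a feasible solution to the aggregated model (A), and $$J(\boldsymbol{z}) = \hat J(\boldsymbol{\hat z}).$$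
   Context: Let $\boldsymbol{G}$ (generators) and $\boldsymbol{T}$ (time periods) be finite nonempty sets. The given real parameters are: operational costs $C^{\mathrm{op}}_g$, investment costs $C^{\mathrm{inv}}_g$, and minimum and maximum installable capacities $\underline{X}_g, \overline{X}_g$ for $g\in\boldsymbol{G}$; a penalty cost $C^{\mathrm{ns}}$ for non-supplied demand; capacity factors $F_{g,t}$ and demands $D_t$ for $g\in\boldsymbol{G}$, $t\in\boldsymbol{T}$; and a sampling time $\Delta>0$. Full-scale model (F): the decision variables are $\boldsymbol{z}=\{x_g, b_g, p_{g,t}, d^{\mathrm{ns}}_t \mid g\in\boldsymbol{G}, t\in\boldsymbol{T}\}$ with $x_g, p_{g,t}, d^{\mathrm{ns}}_t$ real and $b_g\in\{0,1\}$. Minimize $$J(\boldsymbol{z}) := \sum_{g\in\boldsymbol{G}} C^{\mathrm{inv}}_g x_g + \sum_{t\in\boldsymbol{T}}\Big(\sum_{g\in\boldsymbol{G}} C^{\mathrm{op}}_g p_{g,t}\Delta + C^{\mathrm{ns}} d^{\mathrm{ns}}_t\Big)$$ subject to: $\sum_{g\in\boldsymbol{G}} p_{g,t}\Delta + d^{\mathrm{ns}}_t = D_t$ for all $t$; $0\le p_{g,t}\le F_{g,t}x_g$ for all $g,t$; $b_g\underline{X}_g\le x_g\le b_g\overline{X}_g$ for all $g$. Clusters: $\boldsymbol{K}$ is a finite index set, and $\{\boldsymbol{T}_k \mid k\in\boldsymbol{K}\}$ is a partition of $\boldsymbol{T}$ into nonempty subsets (clusters of time periods); $T_k := |\boldsymbol{T}_k|$.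 Aggregated model (A): the decision variables are $\boldsymbol{\hat z}=\{\hat x_g,\hat b_g,\hat p_{g,k},\hat d^{\mathrm{ns}}_k \mid g\in\boldsymbol{G}, k\in\boldsymbol{K}\}$ with $\hat x_g,\hat p_{g,k},\hat d^{\mathrm{ns}}_k$ real and $\hat b_g\in\{0,1\}$. Minimize $$\hat J(\boldsymbol{\hat z}) := \sum_{g\in\boldsymbol{G}} C^{\mathrm{inv}}_g \hat x_g + \sum_{k\in\boldsymbol{K}} T_k\Big(\sum_{g\in\boldsymbol{G}} C^{\mathrm{op}}_g \hat p_{g,k}\Delta + C^{\mathrm{ns}}\hat d^{\mathrm{ns}}_k\Big)$$ subject to: $\sum_{g\in\boldsymbol{G}}\hat p_{g,k}\Delta + \hat d^{\mathrm{ns}}_k = \frac{1}{T_k}\sum_{t\in\boldsymbol{T}_k} D_t$ for all $k$; $0\le \hat p_{g,k}\le \frac{\hat x_g}{T_k}\sum_{t\in\boldsymbol{T}_k}F_{g,t}$ for all $g,k$; $\hat b_g\underline{X}_g\le\hat x_g\le\hat b_g\overline{X}_g$ for all $g$. *)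

(* Defs.v *)
From mathcomp Require Import all_boot all_order all_algebra.
From mathcomp Require Import reals.

Set Implicit Arguments.
Unset Strict Implicit.
Unset Printing Implicit Defensive.

Import Order.TTheory GRing.Theory Num.Theory.
Local Open Scope ring_scope.

Record model_data (R : realType) (G T : finType) := MkModelData {
  Cop : G -> R;
  Cinv : G -> R;
  Xmin : G -> R;
  Xmax : G -> R;
  Cns : R;
  factor : G -> T -> R;
  demand : T -> R;
  Delta : R
}.

(* The index set S is the set of time periods in the full-scale model and
   the set of cluster indices in the aggregated one. *)
Record decision (R : realType) (G S : finType) := MkDecision {
  xvar : G -> R;
  bvar : G -> bool;
  pvar : G -> S -> R;
  dns : S -> R
}.

Definition full_cost (R : realType) (G T : finType) (P : model_data R G T)
    (z : decision R G T) : R :=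
  \sum_(g : G) Cinv P g * xvar z g +
  \sum_(t : T)
    (\sum_(g : G) Cop P g * pvar z g t * Delta P + Cns P * dns z t).

Definition full_feasible (R : realType) (G T : finType)
    (P : model_data R G T) (z : decision R G T) : Prop :=
  [/\ forall t, \sum_(g : G) pvar z g t * Delta P + dns z t = demand P t,
      forall g t, 0 <= pvar z g t <= factor P g t * xvar z g
    & forall g,
        (bvar z g)%:R * Xmin P g <= xvar z g <= (bvar z g)%:R * Xmax P g].

(* Injectivity is needed in addition to the set-level notion: a repeated
   cluster would be counted once per index in the aggregated model. *)
Definition clustering (T K : finType) (C : K -> {set T}) : Prop :=
  injective C /\ partition [set C k | k : K] [set: T].

Definition agg_cost (R : realType) (G T K : finType) (P : model_data R G T)
    (C : K -> {set T}) (z : decision R G K) : R :=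
  \sum_(g : G) Cinv P g * xvar z g +
  \sum_(k : K) #|C k|%:R *
    (\sum_(g : G) Cop P g * pvar z g k * Delta P + Cns P * dns z k).

Definition agg_feasible (R : realType) (G T K : finType)
    (P : model_data R G T) (C : K -> {set T}) (z : decision R G K) : Prop :=
  [/\ forall k, \sum_(g : G) pvar z g k * Delta P + dns z k =
                1 / #|C k|%:R * \sum_(t in C k) demand P t,
      forall g k, 0 <= pvar z g k <=
                  xvar z g / #|C k|%:R * \sum_(t in C k) factor P g t
    & forall g,
        (bvar z g)%:R * Xmin P g <= xvar z g <= (bvar z g)%:R * Xmax P g].

Definition aggregate (R : realType) (G T K : finType) (C : K -> {set T})
    (z : decision R G T) : decision R G K :=
  {| xvar := xvar z;
     bvar := bvar z;
     pvar := fun g k => 1 / #|C k|%:R * \sum_(t in C k) pvar z g t;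
     dns := fun k => 1 / #|C k|%:R * \sum_(t in C k) dns z t |}.

(* Main.v *)
Require Import Defs.
From mathcomp Require Import all_boot all_order all_algebra.
From mathcomp Require Import reals.
Import Order.TTheory GRing.Theory Num.Theory.
Local Open Scope ring_scope.

(** The investment variables are left alone by the aggregation, and everything
    else is averaged over each cluster.  Every constraint of the full-scale
    model at a period [t], and the operating cost incurred at [t], is linear in
    the variables attached to [t] once the investments are fixed; averaging
    commutes with such expressions ([average_linear]), so the aggregated
    constraint of a cluster is the average of the full-scale constraints of
    its periods.  The aggregated model weighs the averaged operating cost of a
    cluster by the cardinality of the cluster, which turns the average back
    into a sum over the cluster ([card_average]); since the clusters cover each
    period once, these sums add up to the full-scale cost
    ([sum_over_clusters]). *)

(** Blocks of a partition are nonempty, so averages over clusters never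
    divide by zero. *)
Lemma cluster_card_gt0 (T K : finType) (C : K -> {set T}) (k : K) :
  clustering C -> (0 < #|C k|)%N.
Proof.
case=> _ /and3P[_ _ C_neq0]; rewrite card_gt0.
by apply: contraNneq C_neq0 => <-; apply: imset_f.
Qed.

(** Disjointness is a property of the set of clusters; injectivity of [C] is
    what lets that set be indexed by [K] without repetition. *)
Lemma sum_over_clusters (V : nmodType) (T K : finType) (C : K -> {set T})
    (f : T -> V) :
  clustering C -> \sum_(t : T) f t = \sum_(k : K) \sum_(t in C k) f t.
Proof.
case=> C_inj /and3P[/eqP C_cover C_triv _].
transitivity (\sum_(t in [set: T]) f t).
  by apply: eq_bigl => t; rewrite inE.
rewrite -C_cover big_trivIset // big_imset //.
by move=> k1 k2 _ _; apply: C_inj.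
Qed.

Lemma card_average (R : numFieldType) (T : finType) (A : {set T})
    (s : R) : (0 < #|A|)%N -> #|A|%:R * (1 / #|A|%:R * s) = s.
Proof. by move=> A_gt0; rewrite mul1r mulVKf // pnatr_eq0 -lt0n. Qed.

(** With [m] the inverse cardinality of [A] this says that averaging commutes
    with the linear form in which dispatch and unserved demand enter both the
    operating cost and, with unit coefficients [c] and [e], the demand
    balance. *)
Lemma average_linear (R : comNzRingType) (G T : finType) (A : {set T})
    (m D e : R) (c : G -> R) (p : G -> T -> R) (d : T -> R) :
  \sum_(g : G) c g * (m * \sum_(t in A) p g t) * D
    + e * (m * \sum_(t in A) d t)
  = m * \sum_(t in A) (\sum_(g : G) c g * p g t * D + e * d t).
Proof.
rewrite big_split mulrDr; congr (_ + _); last by rewrite -mulr_sumr mulrCA.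
rewrite exchange_big mulr_sumr; apply: eq_bigr => g _.
by rewrite /= -mulr_suml -mulr_sumr mulrCA !mulrA.
Qed.

Lemma aggregate_feasible (R : realType) (G T K : finType)
    (P : model_data R G T) (C : K -> {set T}) (z : decision R G T) :
  full_feasible P z -> agg_feasible P C (aggregate C z).
Proof.
case=> balance dispatch capacity; split=> //= [k | g k].
  move: (1 / _) => m.
  have unit_coef q : \sum_g q g * Delta P = \sum_g 1 * q g * Delta P.
    by apply: eq_bigr => g _; rewrite mul1r.
  rewrite unit_coef -[m * _ in LHS]mul1r (average_linear _ _ _ _ _ _ _ (fun=> 1)).
  congr (_ * _); apply: eq_bigr => t _.
  by rewrite -unit_coef mul1r balance.
have inv_ge0 : 0 <= 1 / #|C k|%:R :> R by rewrite divr_ge0 ?ler0n.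
have -> : xvar z g / #|C k|%:R = 1 / #|C k|%:R * xvar z g.
  by rewrite mul1r mulrC.
move: (1 / _) inv_ge0 => m m_ge0; apply/andP; split.
  by rewrite mulr_ge0 // sumr_ge0 // => t _; case/andP: (dispatch g t).
rewrite -mulrA ler_wpM2l // mulr_sumr.
by apply: ler_sum => t _; rewrite mulrC; case/andP: (dispatch g t).
Qed.

Lemma aggregate_cost (R : realType) (G T K : finType)
    (P : model_data R G T) (C : K -> {set T}) (z : decision R G T) :
  clustering C -> full_cost P z = agg_cost P C (aggregate C z).
Proof.
move=> hC; rewrite /full_cost /agg_cost (sum_over_clusters _ _ _ _ _ hC) /=.
congr (_ + _); apply: eq_bigr => k _.
by rewrite average_linear card_average ?cluster_card_gt0.
Qed.

Theorem proposition1 (R : realType) (G T K : finType)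
  (hG : (0 < #|G|)%N) (hT : (0 < #|T|)%N)
  (P : model_data R G T) (hDelta : 0 < Delta P)
  (C : K -> {set T}) (hC : clustering C)
  (z : decision R G T) (hz : full_feasible P z) :
  agg_feasible P C (aggregate C z) /\
  full_cost P z = agg_cost P C (aggregate C z).
Proof. by split; [apply: aggregate_feasible | apply: aggregate_cost]. Qed.
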